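(* Let $\Omega\subseteq\mathbb{R}^2$ be open and let $u:\Omega\to\mathbb{R}^N$ be an immersion in $C^2(\Omega)^N$. Then the following are equivalent: (i) $u$ has Rank-One Locally Minimal Dilation on $\Omega$. (ii) $u$ solves $K_P(Du)\otimes K_P(Du):D^2u=0$ on $\Omega$. (iii) $u$ has constant dilation on connected components of $\Omega$, i.e. $K(Du)$ is constant on each connected component of $\Omega$.
   Context: Here $n=2\le N$. Immersion: a $C^1$ map $u:\Omega\subseteq\mathbb{R}^n\to\mathbb{R}^N$ with $\mathrm{rk}(Du)=n$ everywhere. $Du=(D_iu_\alpha)$ is an $N\times n$ matrix. For $P\in\mathbb{R}^{N\times n}$, $|P|=\mathrm{tr}(P^\top P)^{1/2}$. Dilation function: $K(P)=|P|^2\det(P^\top P)^{-1/n}$ if $\det(P^\top P)>0$, and $K(P)=+\infty$ otherwise (here $n=2$). $K_P$ is its derivative on $\{\det(P^\top P)>0\}$, with components $K_{P_{\alpha i}}$. For an open set $D$, $K_\infty(u,D)=\|K(Du)\|_{L^\infty(D)}$. The system in (ii) in index form (repeated indices summed) is $K_{P_{\alpha i}}(Du)K_{P_{\beta j}}(Du)D^2_{ij}u_\beta=0$ for all $\alpha=1,\dots,N$. Rank-One Locally Minimal Dilation: for every open $D\Subset\Omega$, every $f\in C^1_0(D)$ (a function $f\in C^1(\overline D)$ with $f=0$ on $\partial D$) and every $\xi\in\mathbb{R}^N$ with $|\xi|=1$, $K_\infty(u,D)\le K_\infty(u+f\xi,D)$. *)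

(* Defs.v *)
From HB Require Import structures.
From mathcomp Require Import all_boot all_order all_algebra.
From mathcomp Require Import all_classical all_reals all_analysis.

Set Implicit Arguments.
Unset Strict Implicit.
Unset Printing Implicit Defensive.

Import Order.TTheory GRing.Theory Num.Theory.
Import numFieldNormedType.Exports.

Local Open Scope classical_set_scope.
Local Open Scope ring_scope.

Section Differentiation.
Context (R : realType) (n : nat).
Implicit Types (A D : set 'rV[R]_n) (f : 'rV[R]_n -> R).

Definition partial (i : 'I_n) f (x : 'rV[R]_n) : R := 'D_(delta_mx 0 i) f x.

(* Meant for open A: differentiability and continuity of the partials are
   taken in full neighbourhoods of the points of A. *)
Definition C1_on A f : Prop :=
  forall x, A x ->
    differentiable f x /\ forall i, {for x, continuous (partial i f)}.

Definition C2_on A f : Prop :=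
  C1_on A f /\ forall i, C1_on A (partial i f).

(* C^1 of the closure of an open D: C^1 in D, with f and its partials
   extending continuously to closure D (the extension of f being f itself). *)
Definition C1_closure D f : Prop :=
  [/\ C1_on D f,
      {within closure D, continuous f} &
      forall i, exists2 g : 'rV[R]_n -> R,
        {within closure D, continuous g} & forall x, D x -> partial i f x = g x].

Definition C10 D f : Prop :=
  C1_closure D f /\ forall x, (closure D `\` interior D) x -> f x = 0.

End Differentiation.

Section Maps.
Context (R : realType) (n N : nat).
Implicit Types (u : 'rV[R]_n -> 'rV[R]_N) (A : set 'rV[R]_n).

Definition component (a : 'I_N) u (x : 'rV[R]_n) : R := u x 0 a.

(* The N x n matrix (D_i u_a); the library's [jacobian] is its transpose. *)
Definition gradient u (x : 'rV[R]_n) : 'M[R]_(N, n) :=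
  \matrix_(a, i) partial i (component a u) x.

Definition immersion A u : Prop :=
  (forall a, C1_on A (component a u)) /\ forall x, A x -> \rank (gradient u x) = n.

End Maps.

Section Dilation.
Context (R : realType).

(* The Euclidean norm; the library's norm on matrices is the sup norm. *)
Definition frob (m n : nat) (P : 'M[R]_(m, n)) : R := Num.sqrt (\tr (P^T *m P)).

Definition dilation (N n : nat) (P : 'M[R]_(N, n)) : \bar R :=
  if 0 < \det (P^T *m P)
  then (frob P ^+ 2 * \det (P^T *m P) `^ (- n%:R^-1))%:E
  else +oo%E.

(* K_P, only meaningful where det (P^T P) > 0: there the dilation is finite
   in a neighbourhood of P. *)
Definition dilation_deriv (N n : nat) (P : 'M[R]_(N, n)) : 'M[R]_(N, n) :=
  \matrix_(a, i) 'D_(delta_mx a i) (fun Q => fine (dilation Q)) P.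

(* Identifies R * R, which carries the product Lebesgue measure, with 'rV_2. *)
Definition row2 (z : R * R) : 'rV[R]_2 := \row_i (if i == 0 then z.1 else z.2).

Local Notation leb2 := (@lebesgue_measure R \x @lebesgue_measure R)%E.

(* [\_] extends by 0 outside D, so this is the norm of K(Du) in L^oo(D). *)
Definition Kinf (N : nat) (u : 'rV[R]_2 -> 'rV[R]_N) (D : set 'rV[R]_2) :
    \bar R :=
  Lnorm leb2 +oo%E (((fun x => dilation (gradient u x)) \_ D) \o row2).

Definition rank_one_locally_minimal_dilation (N : nat)
    (Omega : set 'rV[R]_2) (u : 'rV[R]_2 -> 'rV[R]_N) : Prop :=
  forall D : set 'rV[R]_2,
    open D -> compact (closure D) -> closure D `<=` Omega ->
  forall f : 'rV[R]_2 -> R, C10 D f ->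
  forall xi : 'rV[R]_N, frob xi = 1 ->
    (Kinf u D <= Kinf (fun x => u x + f x *: xi)%R D)%E.

Definition dilation_system (N : nat)
    (Omega : set 'rV[R]_2) (u : 'rV[R]_2 -> 'rV[R]_N) : Prop :=
  forall x, Omega x -> forall a : 'I_N,
    \sum_(b < N) \sum_(i < 2) \sum_(j < 2)
      dilation_deriv (gradient u x) a i * dilation_deriv (gradient u x) b j
        * partial i (partial j (component b u)) x = 0.

Definition constant_dilation_on_components (N : nat)
    (Omega : set 'rV[R]_2) (u : 'rV[R]_2 -> 'rV[R]_N) : Prop :=
  forall x, Omega x -> exists c : R,
    forall y, connected_component Omega x y -> dilation (gradient u y) = c%:E.

End Dilation.

(* Main.v *)
Require Import Defs.
From HB Require Import structures.
From mathcomp Require Import all_boot all_order all_algebra.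
From mathcomp Require Import all_classical all_reals all_analysis.
From mathcomp Require Import measurable_realfun ess_sup_inf.
From mathcomp Require Import ring lra.
Import Order.TTheory GRing.Theory Num.Theory.
Import numFieldNormedType.Exports.
Local Open Scope classical_set_scope.
Local Open Scope ring_scope.

Set Implicit Arguments.
Unset Strict Implicit.
Unset Printing Implicit Defensive.

(** Write [k x] for the dilation [K(Du(x))] of the immersion; it is finite and
    C^1 on [Omega]. The proof shows that each of the three properties is
    equivalent to the vanishing of the derivative of [k] on [Omega].

    The system. By the chain rule its left-hand side is [K_P(Du)] applied to the
    gradient of [k]. Let [p] and [q] be the columns of [P], let [g = P^T P] and
    let [S] be the trace-free part of [g]. Then
    [K_P(P) = 2 det(g)^(-1/2) P g^(-1) S], so there are two cases.
    If [S = 0], the map is conformal at the point, [K_P] vanishes, and hence so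
    does the gradient of [k], by the chain rule again. If [S <> 0], then [S] is
    invertible (it is symmetric and trace-free, so [S^2] is a positive multiple
    of the identity), [K_P] is injective, and the system says that the gradient
    of [k] vanishes. See [ddil_conformal], [ddil_represent] and
    [dilation_deriv_eq0].

    Constancy on components. A function with zero derivative is constant along
    segments, hence locally constant, hence constant on connected components;
    conversely the components of an open set are open.

    Vanishing derivative implies minimality. Given [D], [f], [xi] and a point
    [x] of [D], the set [E] of points of [D] where [k] has the value [k x] is
    open, and its boundary lies in the boundary of [D], where [f = 0]. So [f]
    has a critical point in [E] ([exists_critical_point]). There the perturbed
    map has the same gradient as [u], hence dilation [k x]; by continuity the
    essential supremum over [D] of the perturbed dilation is at least [k x].

    Minimality implies vanishing derivative. If [g0], the gradient of [k] at
    [x0], is nonzero, then [K_P] is injective there, and some vector [xi0]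
    satisfies [K_P^T xi0 = g0]. On a disc around [x0] the function
    [f = (|xi0| / 2) (rho^2 - |x - x0|^2)] vanishes on the boundary, and its
    gradient [- |xi0| (x - x0)] does not depend on [rho]. In the direction
    [xi0 / |xi0|] it cancels the first-order variation of the dilation at
    [x0], so that the perturbed dilation is at most [k x0 + o(rho)] on the disc,
    whereas [k] itself exceeds [k x0] by a fixed multiple of [rho] somewhere on
    it. For small [rho] this contradicts minimality. *)

(** * The dilation of a matrix with two columns and its differential *)

Lemma sum_ord2 (V : nmodType) (F : 'I_2 -> V) : \sum_i F i = F 0 + F 1.
Proof.
by rewrite !big_ord_recl big_ord0 addr0; congr (F _ + F _); exact/val_inj.
Qed.

Section Dilation.
Context (R : realType) (N : nat).
Implicit Types (P Q : 'M[R]_(N, 2)) (c : 'cV[R]_2) (v w : 'rV[R]_2).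

Definition cdot P Q (j k : 'I_2) : R := \sum_a P a j * Q a k.

Lemma cdotC P Q j k : cdot P Q j k = cdot Q P k j.
Proof. by apply: eq_bigr => a _; rewrite mulrC. Qed.

Lemma cdotE P Q j k : (P^T *m Q) j k = cdot P Q j k.
Proof. by rewrite !mxE; apply: eq_bigr => a _; rewrite !mxE. Qed.

Lemma cdot_ge0 P j : 0 <= cdot P P j j.
Proof. by apply: sumr_ge0 => a _; rewrite -expr2 sqr_ge0. Qed.

Definition gdet P := cdot P P 0 0 * cdot P P 1 1 - cdot P P 0 1 ^+ 2.

Lemma det_gram P : \det (P^T *m P) = gdet P.
Proof.
rewrite (expand_det_row _ 0) !big_ord_recl big_ord0 addr0 /cofactor.
rewrite !det_mx11 !mxE /=.
have -> : lift (0 : 'I_2) 0 = 1 by apply/val_inj.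
have -> : lift (1 : 'I_2) 0 = 0 by apply/val_inj.
rewrite -!/(cdot _ _ _ _) /bump /= addn0 expr0 mul1r addn0 expr1.
have cE j k : \sum_j0 P^T j j0 * P j0 k = cdot P P j k.
  by apply: eq_bigr => a _; rewrite mxE.
by rewrite !cE (cdotC _ _ 1 0) /gdet; ring.
Qed.

(** The finite values of the dilation, as a smooth expression to differentiate;
    [dilation] agrees with it where the Gram determinant is positive. *)
Definition dil P : R := (cdot P P 0 0 + cdot P P 1 1) * gdet P `^ (- 2^-1).

Lemma dil_ge0 P : 0 <= dil P.
Proof.
by rewrite mulr_ge0 ?powR_ge0 // addr_ge0 ?cdot_ge0.
Qed.

Lemma dilationE P : 0 < gdet P -> dilation P = (dil P)%:E.
Proof.
move=> P_gt0; rewrite /dilation det_gram P_gt0 /frob sqr_sqrtr.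
  by rewrite /mxtrace sum_ord2 !cdotE.
by apply: sumr_ge0 => i _; rewrite cdotE cdot_ge0.
Qed.

(** With [E], [F], [G] the entries of the Gram matrix, [E (EG - F^2)] is the squared length of [E q - F p],
    which is a nontrivial combination of the columns [p] and [q]. *)
Lemma gdet_gt0 P : \rank P = 2%N -> 0 < gdet P.
Proof.
move=> rkP.
pose E := cdot P P 0 0; pose F := cdot P P 0 1.
have ker0 (x y : R) : (forall a, P a 0 * x + P a 1 * y = 0) -> x = 0 /\ y = 0.
  move=> Pxy; pose z : 'rV[R]_2 := \row_i (if i == 0 then x else y).
  have : z *m P^T = 0.
    apply/rowP => a; rewrite !mxE sum_ord2 !mxE /=.
    by rewrite -[RHS](Pxy a); ring.
  have Pfree : row_free P^T by rewrite /row_free mxrank_tr rkP.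
  rewrite -(mul0mx 1 P^T) => /(row_free_inj Pfree) z0.
  have := congr1 (fun m : 'rV[R]_2 => m 0 0) z0.
  have := congr1 (fun m : 'rV[R]_2 => m 0 1) z0.
  by rewrite !mxE.
have E_gt0 : 0 < E.
  rewrite lt_def cdot_ge0 andbT; apply/eqP => E0.
  have [] := ker0 1 0; last by move/eqP; rewrite oner_eq0.
  move=> a; rewrite mulr0 addr0 mulr1; apply/eqP; rewrite -sqrf_eq0 expr2.
  have /psumr_eq0P := E0 => -> // b _; by rewrite -expr2 sqr_ge0.
have Egdet : E * gdet P = \sum_a (P a 0 * - F + P a 1 * E) ^+ 2.
  have -> (x y : R) : \sum_a (P a 0 * x + P a 1 * y) ^+ 2 =
      x ^+ 2 * cdot P P 0 0 + 2 * x * y * cdot P P 0 1 + y ^+ 2 * cdot P P 1 1.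
    rewrite /cdot !mulr_sumr -!big_split; apply: eq_bigr => a _ /=; ring.
  by rewrite /gdet -/E -/F; ring.
rewrite -(pmulr_rgt0 _ E_gt0) Egdet lt_def sumr_ge0 ?andbT; last first.
  by move=> a _; exact: sqr_ge0.
apply/eqP => S0; have [] := ker0 (- F) E; last by move=> _ /eqP; rewrite gt_eqF.
move=> a; apply/eqP; rewrite -sqrf_eq0; apply/eqP.
by have /psumr_eq0P := S0 => -> // b _; exact: sqr_ge0.
Qed.

(** The differential of the dilation at [P] applied to [Q]. The last bracket is
    half the derivative of the Gram determinant, by Jacobi's formula. *)
Definition ddil P Q : R :=
  2 * gdet P `^ (- 2^-1) *
  (cdot P Q 0 0 + cdot P Q 1 1 - (cdot P P 0 0 + cdot P P 1 1) / (2 * gdet P) *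
    (cdot P P 1 1 * cdot P Q 0 0 - cdot P P 0 1 * (cdot P Q 0 1 + cdot P Q 1 0)
     + cdot P P 0 0 * cdot P Q 1 1)).

Lemma ddil_sum (I : finType) P (x : I -> R) (Q : I -> 'M[R]_(N, 2)) :
  ddil P (\sum_i x i *: Q i) = \sum_i x i * ddil P (Q i).
Proof.
have cS j k : cdot P (\sum_i x i *: Q i) j k = \sum_i x i * cdot P (Q i) j k.
  rewrite /cdot; under eq_bigr do rewrite summxE mulr_sumr.
  rewrite exchange_big; apply: eq_bigr => i _; rewrite mulr_sumr.
  by apply: eq_bigr => a _; rewrite mxE; ring.
rewrite /ddil !cS -!big_split !mulr_sumr -sumrB -!big_split !mulr_sumr -sumrB.
by rewrite mulr_sumr; apply: eq_bigr => i _ /=; ring.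
Qed.

Lemma ddilB P (Q1 Q2 : 'M[R]_(N, 2)) : ddil P (Q1 - Q2) = ddil P Q1 - ddil P Q2.
Proof.
have := ddil_sum P (fun i : 'I_2 => (-1) ^+ i) (fun i => if i == 0 then Q1 else Q2).
by rewrite !sum_ord2 /= expr0 expr1 !scale1r !mul1r scaleN1r mulN1r.
Qed.

(** The trace-free part of the Gram matrix, applied to [c]. *)
Definition tfgram P c (i : 'I_2) : R :=
  let a := (cdot P P 0 0 - cdot P P 1 1) / 2 in
  let b := cdot P P 0 1 in
  if i == 0 then a * c 0 0 + b * c 1 0 else b * c 0 0 - a * c 1 0.

(** On tangential rank-one matrices the inverse Gram matrix in the differential
    cancels, and only the trace-free part of the Gram matrix is left. *)
Lemma ddil_rank_one P c v : gdet P != 0 ->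
  ddil P (P *m c *m v) =
  2 * gdet P `^ (- 2^-1) * (tfgram P c 0 * v 0 0 + tfgram P c 1 * v 0 1).
Proof.
move=> Pn0; have cPE j k : cdot P (P *m c *m v) j k =
    (cdot P P j 0 * c 0 0 + cdot P P j 1 * c 1 0) * v 0 k.
  rewrite /cdot mulrDl !mulr_suml -big_split; apply: eq_bigr => a _ /=.
  rewrite mxE big_ord1 mxE sum_ord2.
  by ring.
rewrite /ddil !cPE (cdotC _ _ 1 0) /tfgram /=; congr (_ * _).
move: Pn0; rewrite /gdet; set E := cdot P P 0 0; set F := cdot P P 0 1.
by set G := cdot P P 1 1 => Pn0; field; rewrite Pn0 ?pnatr_eq0.
Qed.

(** The trace-free part of the Gram matrix squares to [shear P] times the
    identity. It is zero exactly when the columns of [P] are orthogonal and of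
    equal length, that is, when [P] is conformal. *)
Definition shear P : R :=
  ((cdot P P 0 0 - cdot P P 1 1) / 2) ^+ 2 + cdot P P 0 1 ^+ 2.

(** Conformal matrices minimize the dilation, so they are critical for it. *)
Lemma ddil_conformal P Q : gdet P != 0 -> shear P = 0 -> ddil P Q = 0.
Proof.
move=> Pn0 /eqP; rewrite paddr_eq0 ?sqr_ge0 // !sqrf_eq0.
move=> /andP[EG /eqP F0]; have {}EG : cdot P P 0 0 = cdot P P 1 1.
  by apply/eqP; rewrite -subr_eq0; move: EG; rewrite mulf_eq0 invr_eq0 pnatr_eq0 orbF.
rewrite /ddil; move: Pn0; rewrite /gdet EG F0 => Pn0.
have G0 : cdot P P 1 1 != 0 by apply: contra Pn0 => /eqP ->; rewrite expr0n mul0r subr0.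
by rewrite expr0n /= subr0 mul0r subr0; field.
Qed.

(** Surjectivity of the transpose of [K_P] away from conformal matrices: as the
    trace-free part of the Gram matrix squares to a nonzero scalar, it is its own
    inverse up to that scalar, and [xi] can be taken tangential. *)
Lemma ddil_represent P v : gdet P != 0 -> shear P != 0 ->
  exists xi : 'cV[R]_N, forall w, ddil P (xi *m w) = v 0 0 * w 0 0 + v 0 1 * w 0 1.
Proof.
move=> Pn0 s0; pose d := 2 * gdet P `^ (- 2^-1) * shear P.
pose c : 'cV[R]_2 := \col_i (tfgram P v^T i / d).
exists (P *m c) => w; rewrite ddil_rank_one //.
have p0 : gdet P `^ (- 2^-1) != 0 by rewrite powR_eq0 negb_and Pn0.
rewrite /c /tfgram /= !mxE /= /d; move: s0; rewrite /shear.
set a := (_ - _) / 2; set b := cdot P P 0 1; set p := _ `^ _ in p0 *.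
by move=> s0; field; rewrite s0 p0.
Qed.

End Dilation.

(** * Differentiating the dilation along a family of matrices *)

Section Calculus.
Context (R : realType) (V : normedModType R).

Lemma is_diff_sum (I : finType) (f df : I -> V -> R) (x : V) :
  (forall i, is_diff x (f i) (df i)) ->
  is_diff x (fun y => \sum_i f i y) (fun v => \sum_i df i v).
Proof.
move=> dfx.
have -> : (fun y => \sum_i f i y) = \sum_i f i by apply/funext => y; rewrite fct_sumE.
have -> : (fun v => \sum_i df i v) = \sum_i df i by apply/funext => v; rewrite fct_sumE.
elim/big_ind2: _ => [|g dg h dh gx hx|i _]; last exact: dfx.
  exact: is_diff_cst.
exact: is_diffD.
Qed.

Lemma is_diff_powR (f df : V -> R) (p : R) (x : V) : 0 < f x ->
  is_diff x f df ->
  is_diff x (fun y => f y `^ p) (fun v => df v * (p * f x `^ (p - 1))).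
Proof.
move=> fx_gt0 fx; have [pd pE] := is_derive1_powR p fx_gt0.
have pdiff : is_diff (f x) (fun y => y `^ p) ( *:%R^~ (p * f x `^ (p - 1))).
  apply: DiffDef; first exact/derivable1_diffP.
  by rewrite deriv1E // derive1E pE.
exact: (is_diff_comp fx pdiff).
Qed.

Context (N : nat).
Implicit Types (X dX : V -> 'M[R]_(N, 2)).

Lemma is_diff_cdot X dX (x : V) j k :
  (forall a i, is_diff x (fun y => X y a i) (fun v => dX v a i)) ->
  is_diff x (fun y => cdot (X y) (X y) j k)
            (fun v => cdot (X x) (dX v) j k + cdot (X x) (dX v) k j).
Proof.
move=> dXx; apply: (@is_diff_eq _ _ _ _ (fun v => \sum_a
    (X x a j * dX v a k + X x a k * dX v a j))); last first.
  by apply/funext => v; rewrite big_split.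
by apply: is_diff_sum => a; exact: is_diffM.
Qed.

Lemma is_diff_gdet X dX (x : V) :
  (forall a i, is_diff x (fun y => X y a i) (fun v => dX v a i)) ->
  is_diff x (fun y => gdet (X y)) (fun v =>
    2 * (cdot (X x) (X x) 1 1 * cdot (X x) (dX v) 0 0
     - cdot (X x) (X x) 0 1 * (cdot (X x) (dX v) 0 1 + cdot (X x) (dX v) 1 0)
     + cdot (X x) (X x) 0 0 * cdot (X x) (dX v) 1 1)).
Proof.
move=> dXx.
have d00 := is_diff_cdot 0 0 dXx; have d11 := is_diff_cdot 1 1 dXx.
have d01 := is_diff_cdot 0 1 dXx.
have := is_diffB (is_diffM d00 d11) (is_diffM d01 d01).
move=> /is_diff_eq; apply; apply/funext => v; rewrite !fctE /=.
rewrite /GRing.scale /=; ring.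
Qed.

(** One statement serves three uses: the identity family gives [K_P], the family
    [Du] gives the gradient of [k], and a perturbed gradient gives the dilation
    of the competitor. *)
Lemma is_diff_dil X dX (x : V) :
  (forall a i, is_diff x (fun y => X y a i) (fun v => dX v a i)) ->
  0 < gdet (X x) -> is_diff x (fun y => dil (X y)) (fun v => ddil (X x) (dX v)).
Proof.
move=> dXx Xx_gt0.
have d00 := is_diff_cdot 0 0 dXx; have d11 := is_diff_cdot 1 1 dXx.
have dd := is_diff_powR (- 2^-1) Xx_gt0 (is_diff_gdet dXx).
have := is_diffM (is_diffD d00 d11) dd.
move=> /is_diff_eq; apply; apply/funext => v; rewrite !fctE /=.
rewrite /GRing.scale /= powRD; last by rewrite (gt_eqF Xx_gt0) implybT.
rewrite powR_inv1 ?ltW // /ddil.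
set p := gdet _ `^ _.
have d0 : gdet (X x) != 0 by rewrite gt_eqF.
by field.
Qed.

End Calculus.

(** * Pointwise bounds and the essential supremum *)

Section EssentialSupremum.
Context (R : realType) (N : nat).
Local Notation leb2 := (@lebesgue_measure R \x @lebesgue_measure R)%E.

Lemma leb2_box_gt0 (a b e : R) : 0 < e -> (0 < leb2 (ball a e `*` ball b e))%E.
Proof.
move=> e_gt0; rewrite product_measure1E; [|exact: measurable_ball|exact: measurable_ball].
have le_gt0 c : (0 < lebesgue_measure (ball c e : set R))%E.
  rewrite (lebesgue_measure_ball c (ltW e_gt0)) lte_fin.
  by rewrite pmulrn_lgt0.
apply: (mule_gt0 (le_gt0 a) (le_gt0 b)).
Qed.

(** A lower bound near a single point already forces one on the essential
    supremum, since neighbourhoods contain boxes of positive measure. *)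
Lemma Kinf_ge (u : 'rV[R]_2 -> 'rV[R]_N) (D : set 'rV[R]_2) x (r : R) :
  open D -> D x -> (\forall y \near x, r%:E <= dilation (gradient u y))%E ->
  (r%:E <= Kinf u D)%E.
Proof.
move=> openD Dx near_r.
have : \forall y \near x, D y /\ (r%:E <= dilation (gradient u y))%E.
  by apply: filterI => //; exact: open_nbhs_nbhs.
move=> /nbhs_ballP[e /= e_gt0 xe].
pose B := ball (x 0 0) e `*` ball (x 0 1) e.
have mB : measurable B by apply: measurableX; exact: measurable_ball.
have B_gt0 : (0 < leb2 B)%E by exact: leb2_box_gt0.
have Br z : B z -> D (row2 z) /\ (r%:E <= dilation (gradient u (row2 z)))%E.
  move=> [/= z1 z2]; apply: xe; split => // i j; rewrite (ord1 i) !mxE.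
  by case: (unliftP 0 j) => [k|] -> //; rewrite (ord1 k) /=;
    rewrite (_ : lift _ _ = 1) //; exact/val_inj.
rewrite /Kinf unlock ifT; last first.
  by apply: (lt_le_trans B_gt0); apply: le_measure; rewrite ?inE.
rewrite leNgt; apply/negP; set s := ess_sup _ _ => sr.
have [Z [mZ Z0 sZ]] := ess_sup_ge leb2 (abse \o
  (((fun x => dilation (gradient u x)) \_ D) \o @row2 R)).
have : (leb2 B <= leb2 Z)%E.
  apply: le_measure; rewrite ?inE // => z /[dup] Bz /Br[Dz rz].
  apply: sZ => /=; rewrite -/s patchT ?inE // => sz.
  have := lt_le_trans (le_lt_trans sz sr) rz.
  by rewrite ltNge => /negP; apply; exact: lee_abs.
by rewrite Z0 leNgt B_gt0.
Qed.

Lemma Kinf_le (u : 'rV[R]_2 -> 'rV[R]_N) (D : set 'rV[R]_2) (c : R) : 0 <= c ->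
  (forall x, D x -> `|dilation (gradient u x)| <= c%:E)%E -> (Kinf u D <= c%:E)%E.
Proof.
move=> c_ge0 Dc; rewrite /Kinf unlock; case: ifP => _; last by rewrite lee_fin.
apply/ess_supP; apply: nearW => z /=; rewrite patchE; case: ifPn => [|_].
  by rewrite inE => /Dc.
by rewrite abse0 lee_fin.
Qed.

End EssentialSupremum.

(** * Locally constant functions, components and critical points *)

Section LocallyConstant.
Context (R : realType) (V : normedModType R).
Implicit Types (A D E : set V) (f : V -> R) (x y v : V).

Lemma is_diff_line x v (s : R) :
  is_diff s (fun t : R => x + t *: v) (fun t => t *: v).
Proof.
have := is_diffD (is_diff_cst x s) (is_diff_scalel s v).
by move=> /is_diff_eq; apply; apply/funext => t; rewrite fctE /= add0r.
Qed.

Lemma is_derive_line f x v (s : R) : differentiable f (x + s *: v) ->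
  is_derive s 1 (fun t : R => f (x + t *: v)) ('D_v f (x + s *: v)).
Proof.
move=> df; have fl := is_diff_comp (is_diff_line x v s) (differentiableP df).
apply: DeriveDef; first exact: diff_derivable.
by rewrite deriveE ?diff_val /= ?scale1r ?deriveE.
Qed.

Lemma is_diff0_near f x (e : R) : is_diff x f 0 -> 0 < e ->
  \forall y \near x, `|f y - f x| <= e * `|y - x|.
Proof.
move=> [df f0] e_gt0; have := diff_locallyx df; set o := 'o _ => fo.
have /(littleoP [littleo of o]) /nbhs_ballP[d /= d_gt0 od] := e_gt0.
apply/nbhs_ballP; exists d => // y xy.
have /od : ball 0 d (y - x).
  by move: xy; rewrite -!ball_normE /= sub0r normrN distrC.
by have := fo (y - x); rewrite subrK f0 addr0 => ->; rewrite [f x + _]addrC addrK.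
Qed.

Lemma near_derive_gt f x v (c : R) : derivable f x v -> c < 'D_v f x ->
  \forall s \near 0^'+, f x + s * c < f (x + s *: v).
Proof.
move=> dfx cD.
have lim_q : (fun h => h^-1 *: ((f \o shift x) (h *: v) - f x)) @ 0^' --> 'D_v f x.
  exact: dfx.
have [e /= e_gt0 near_q] := cvgr_gt _ lim_q _ cD.
exists e => //= s es s_gt0.
have := near_q s es (lt0r_neq0 s_gt0).
by rewrite /= [s *: v + x]addrC /GRing.scale /= ltr_pdivlMl // ltrBrDl.
Qed.

Lemma segment_ball x y (e t : R) : 0 <= t <= 1 -> ball x e y ->
  ball x e (x + t *: (y - x)).
Proof.
move=> /andP[t0 t1]; rewrite -!ball_normE /= => xy.
rewrite opprD addNKr normrN normrZ ger0_norm //.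
by rewrite (le_lt_trans _ xy) // distrC ler_piMl.
Qed.

(** The mean value theorem along the segments issued from the centre of a ball. *)
Lemma derive0_locally_constant A f : open A ->
  (forall x, A x -> differentiable f x /\ forall v, 'D_v f x = 0) ->
  forall x, A x -> \forall y \near x, f y = f x.
Proof.
move=> openA fA x Ax.
have /nbhs_ballP[e /= e_gt0 xeA] := open_nbhs_nbhs (conj openA Ax).
apply/nbhs_ballP; exists e => // y xy.
have fl (t : R) : 0 <= t <= 1 ->
    is_derive t 1 (fun s => f (x + s *: (y - x))) 0.
  move=> t01; have /fA[dft Dft] := xeA _ (segment_ball t01 xy).
  by rewrite -(Dft (y - x)); exact: is_derive_line.
have [||c _] := @MVT_segment R (fun s => f (x + s *: (y - x))) (fun=> 0) _ _ ler01.
- by move=> t; rewrite in_itv /= => /andP[t0 t1]; apply: fl; rewrite !ltW.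
- apply: derivable_within_continuous => t; rewrite in_itv /= => /fl t01.
  exact: ex_derive.
- by rewrite mul0r scale1r scale0r addr0 subrKC => /eqP; rewrite subr_eq0 => /eqP.
Qed.

(** Balls are connected, being unions of segments through the centre. *)
Lemma near_connected_component A x : open A -> A x ->
  \forall y \near x, connected_component A x y.
Proof.
move=> openA Ax.
have /nbhs_ballP[e /= e_gt0 xeA] := open_nbhs_nbhs (conj openA Ax).
apply/nbhs_ballP; exists e => // y xy.
exists ((fun t : R => x + t *: (y - x)) @` `[0, 1]); last first.
  by exists 1; rewrite ?scale1r ?subrKC //= in_itv /= lexx ler01.
split.
- by exists 0; rewrite ?scale0r ?addr0 //= in_itv /= lexx ler01.
- move=> _ [t /= t01 <-]; exact/xeA/segment_ball.
- apply: connected_continuous_connected; first exact: segment_connected.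
  apply: continuous_subspaceT => t.
  by apply: differentiable_continuous; have := is_diff_line x (y - x) t.
Qed.

(** The level set of [f] through [x] is open and closed relative to the
    component of [x]. *)
Lemma locally_constant_component A f : open A ->
  (forall x, A x -> \forall y \near x, f y = f x) ->
  forall x, A x -> forall y, connected_component A x y -> f y = f x.
Proof.
move=> openA fA x Ax y Axy.
pose C := connected_component A x.
have openP (Q : set R) : open [set z | A z /\ Q (f z)].
  rewrite openE => z [Az Qz]; near=> w; split.
    by near: w; exact: open_nbhs_nbhs.
  by have -> : f w = f z by near: w; exact: fA.
have CA := @connected_component_sub _ A x.
have CE : C `&` [set z | f z = f x] = C.
  apply: (@component_connected _ A x).
  - by exists x; split => //; exact: connected_component_refl.
  - exists [set z | A z /\ f z = f x]; first exact: (openP [set f x]).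
    by apply/seteqP; split => z [Cz] => [fz|[]//]; split => //; split => //; exact: CA.
  - exists (~` [set z | A z /\ f z <> f x]).
      by apply: open_closedC; exact: (openP (~` [set f x])).
    apply/seteqP; split => z [Cz] => [fz|nz]; split => //.
      by move=> [].
    by apply: contrapT => fz; apply: nz; split => //; exact: CA.
by move: Axy; rewrite -/C -CE => -[].
Unshelve. all: by end_near. Qed.

Lemma derive0_at_max f E x : open E -> (forall z, E z -> differentiable f z) ->
  E x -> (forall z, E z -> f z <= f x) -> forall v, 'D_v f x = 0.
Proof.
move=> openE fdiff Ex fmax v.
have /nbhs_ballP[e /= e_gt0 xeE] := open_nbhs_nbhs (conj openE Ex).
pose d := e / (`|v| + 1).
have v1_gt0 : 0 < `|v| + 1 by rewrite ltr_wpDl.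
have d_gt0 : 0 < d by rewrite divr_gt0.
have lineE t : t \in `]-d, d[ -> E (x + t *: v).
  rewrite in_itv /= -ltr_norml => td; apply: xeE.
  rewrite -ball_normE /= opprD addNKr normrN normrZ.
  rewrite (@le_lt_trans _ _ (`|t| * (`|v| + 1))) ?ler_wpM2l ?lerDl //.
  by rewrite -ltr_pdivlMr.
have d0 : 0 \in `]-d, d[ by rewrite in_itv /= oppr_lt0 d_gt0.
have fl := is_derive_line (fdiff _ (lineE _ d0)).
have [] := @derive1_at_max R (fun t => f (x + t *: v)) (- d) d 0 _ _ d0 _.
- by rewrite ge0_cp // ltW.
- by move=> t /lineE/fdiff/is_derive_line fd; exact: ex_derive.
- by move=> t /lineE/fmax; rewrite scale0r addr0.
- by have [_] := fl; rewrite scale0r addr0 => -> _.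
Qed.

(** Rolle's argument. A maximum or a minimum over the closure is attained in [E],
    or else both are attained on the boundary, where [f] is zero, and then [f]
    vanishes identically. *)
Lemma exists_critical_point f E : open E -> compact (closure E) -> E !=set0 ->
  {within closure E, continuous f} ->
  (forall x, E x -> differentiable f x) ->
  (forall x, (closure E `\` E) x -> f x = 0) ->
  exists2 x, E x & forall v, 'D_v f x = 0.
Proof.
move=> openE compE [x0 Ex0] fcont fdiff f0.
have cE0 : closure E !=set0 by exists x0; exact: subset_closure.
have [M /set_mem cM fM] := compact_EVT_max cE0 compE fcont.
have [m /set_mem cm fm] := compact_EVT_min cE0 compE fcont.
have subcE z : E z -> z \in closure E by move=> Ez; rewrite inE; exact: subset_closure.
have [EM|nEM] := pselect (E M).
  by exists M => //; apply: (derive0_at_max openE fdiff EM) => z /subcE; exact: fM.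
have [Em|nEm] := pselect (E m).
  exists m => // v; have := @derive0_at_max (- f) E m openE _ Em _ v.
  rewrite deriveN; last exact/diff_derivable/fdiff.
  move=> Dm; apply/eqP; rewrite -oppr_eq0; apply/eqP/Dm => z Ez.
    exact/differentiableN/fdiff.
  by rewrite lerN2 fm ?subcE.
exists x0 => //; apply: (derive0_at_max openE fdiff Ex0) => z Ez.
have fz : f z <= 0 by rewrite -(f0 M (conj cM nEM)) fM // subcE.
apply: (le_trans fz); rewrite -(f0 m (conj cm nEm)).
exact: fm (subcE _ Ex0).
Qed.

End LocallyConstant.

(** * The kernel of the derivative of the dilation *)

Section DilationDerivative.
Context (R : realType) (N : nat).
Implicit Types (P Q : 'M[R]_(N, 2)).

Lemma is_diff_coord (m n : nat) (M : 'M[R]_(m, n)) a i :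
  is_diff M (fun A => A a i) (fun A => A a i).
Proof.
have @f : {linear 'M[R]_(m, n) -> R}.
  by exists (fun Q : 'M[R]_(_, _) => Q a i); do 2![eexists]; do ?[constructor];
     rewrite ?mxE // => ? *; rewrite ?mxE //; move=> ?; rewrite !mxE.
apply: DiffDef; first exact: differentiable_coord.
rewrite (_ : (fun _ => _) = f) //; apply: diff_lin; exact/coord_continuous.
Qed.

Lemma near_gdet_gt0 (V : normedModType R) (X : V -> 'M[R]_(N, 2)) x :
  (forall a i, differentiable (fun y => X y a i) x) -> 0 < gdet (X x) ->
  \forall y \near x, 0 < gdet (X y).
Proof.
move=> dX Xx.
have dXx a i : is_diff x (fun y => X y a i)
    (fun v => (\matrix_(b, j) 'd (fun y => X y b j) x v) a i).
  apply: is_diff_eq; first exact/differentiableP/dX.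
  by apply/funext => v; rewrite mxE.
have [+ _] := is_diff_gdet dXx.
by move=> /differentiable_continuous/cvgr_gt; exact.
Qed.

Lemma dilation_derivE P a i : 0 < gdet P ->
  dilation_deriv P a i = ddil P (delta_mx a i).
Proof.
move=> P_gt0; rewrite mxE.
have dP b j := is_diff_coord P b j.
rewrite (@near_eq_derive _ _ _ _ (fun Q => dil Q)); last first.
  near=> Q; rewrite dilationE //; near: Q; exact: (@near_gdet_gt0 _ id).
have := is_diff_dil (X := id) (dX := id) dP P_gt0 => dK.
by rewrite deriveE ?diff_val.
Unshelve. all: by end_near. Qed.

(** Linearity: the entries of [K_P] are the values of [ddil] at the elementary
    matrices. *)
Lemma ddilE P Q : ddil P Q = \sum_b \sum_j Q b j * ddil P (delta_mx b j).
Proof.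
rewrite pair_bigA /= -(@ddil_sum _ _ _ P (fun p => Q p.1 p.2)
  (fun p => delta_mx p.1 p.2)).
by rewrite -(pair_bigA _ (fun b j => Q b j *: delta_mx b j)) -matrix_sum_delta.
Qed.

(** [K_P] annihilates no nonzero vector unless it is zero itself. In the
    application the numbers [ddil P (Q i)] are the partial derivatives of [k], so
    that they vanish in the conformal case too. *)
Lemma dilation_deriv_eq0 P (Q : 'I_2 -> 'M[R]_(N, 2)) : 0 < gdet P ->
  (forall a, \sum_i ddil P (Q i) * dilation_deriv P a i = 0) <->
  (forall i, ddil P (Q i) = 0).
Proof.
move=> P_gt0; split=> [sys|v0 a]; last first.
  by rewrite big1 // => i _; rewrite v0 mul0r.
have Pn0 : gdet P != 0 by rewrite gt_eqF.
have [s0 i|s0] := eqVneq (shear P) 0; first exact: ddil_conformal.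
pose v : 'rV_2 := \row_i ddil P (Q i).
have [xi xiP] := ddil_represent v Pn0 s0.
have : v 0 0 * v 0 0 + v 0 1 * v 0 1 = 0.
  rewrite -xiP ddilE big1 // => a _.
  transitivity (xi a 0 * \sum_i ddil P (Q i) * dilation_deriv P a i).
    rewrite mulr_sumr; apply: eq_bigr => j _.
    by rewrite dilation_derivE // [in LHS]mxE big_ord1 mxE mulrA.
  by rewrite sys mulr0.
rewrite -!expr2 => /eqP; rewrite paddr_eq0 ?sqr_ge0 // !sqrf_eq0 !mxE.
move=> /andP[/eqP Q0 /eqP Q1] i.
by case: (unliftP 0 i) => [k|] -> //; rewrite (ord1 k) -[RHS]Q1; congr (ddil _ (Q _));
  apply/val_inj.
Qed.

End DilationDerivative.

(** * Rank-one perturbations and paraboloids *)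

Section Perturbation.
Context (R : realType).

Lemma derive_partials n (f : 'rV[R]_n -> R) x v : differentiable f x ->
  'D_v f x = \sum_i v 0 i * partial i f x.
Proof.
move=> df; rewrite deriveE // [in LHS](row_sum_delta v) linear_sum /=.
by apply: eq_bigr => i _; rewrite linearZ /partial deriveE.
Qed.

Lemma gradient_perturb n N (u : 'rV[R]_n -> 'rV[R]_N) (f : 'rV[R]_n -> R)
    (xi : 'rV[R]_N) x :
  (forall a, differentiable (component a u) x) -> differentiable f x ->
  gradient (fun y => u y + f y *: xi) x =
  gradient u x + xi^T *m \row_i partial i f x.
Proof.
move=> du df; apply/matrixP => a i; rewrite !mxE big_ord1 !mxE /partial.
have -> : component a (fun y => u y + f y *: xi) =
    component a u + (xi 0 a) *: f.
  by apply/funext => y; rewrite /component fctE /= !mxE mulrC.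
rewrite deriveD ?deriveZ //; first exact: diff_derivable.
  exact: diff_derivable.
exact/derivableZ/diff_derivable.
Qed.

Lemma cvg_mx (T : topologicalType) m n (X : T -> 'M[R]_(m, n)) x :
  (forall i j, {for x, continuous (fun y => X y i j)}) -> {for x, continuous X}.
Proof.
move=> Xc A [B XB BA]; near=> y; apply: BA; near: y.
by apply: filter_forall => i; apply: filter_forall => j; exact: Xc.
Unshelve. all: by end_near. Qed.

(** Near a matrix of positive Gram determinant the dilation is finite and
    continuous. *)
Lemma near_dilation_gt N (T : topologicalType) (X : T -> 'M[R]_(N, 2)) x r :
  {for x, continuous X} -> 0 < gdet (X x) -> r < dil (X x) ->
  \forall y \near x, (r%:E <= dilation (X y))%E.
Proof.
move=> Xc Xx rX.
have dX := is_diff_coord (X x).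
have near_gt0 : \forall P \near X x, 0 < gdet P.
  exact: (@near_gdet_gt0 _ _ _ id).
have [+ _] := is_diff_dil (X := id) (dX := id) dX Xx.
move=> /differentiable_continuous/cvgr_gt /(_ r rX) near_r.
have /Xc : \forall P \near X x, (r%:E <= dilation P)%E; last exact.
near=> P; rewrite dilationE ?lee_fin ?ltW //; near: P => //.
Unshelve. all: by end_near. Qed.

(** The Euclidean square. Unlike the sup norm it is smooth, so that a C^1 profile
    can vanish on the boundary of its sublevel sets. *)
Definition sqnorm (z : 'rV[R]_2) := z 0 0 ^+ 2 + z 0 1 ^+ 2.

Lemma sqnormZ (a : R) z : sqnorm (a *: z) = a ^+ 2 * sqnorm z.
Proof. by rewrite /sqnorm !mxE; ring. Qed.

Lemma norm_sqnorm (z : 'rV[R]_2) (r : R) : 0 <= r -> sqnorm z <= r ^+ 2 -> `|z| <= r.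
Proof.
move=> r0 zr; rewrite [leLHS]/Num.Def.normr /= mx_normrE.
apply/bigmax_leP; split => // -[a i] _ /=.
rewrite (ord1 a) -(@ler_pXn2r _ 2) ?nnegrE //; rewrite real_normK ?num_real //.
apply: (le_trans _ zr); rewrite /sqnorm.
case: (unliftP 0 i) => [j|] -> //; last by rewrite lerDl sqr_ge0.
by rewrite (ord1 j) (_ : lift _ _ = 1) ?lerDr ?sqr_ge0 //; exact/val_inj.
Qed.

Lemma is_diff_coordB n (x0 x : 'rV[R]_n) i :
  is_diff x (fun y => (y - x0) 0 i) (fun v => v 0 i).
Proof.
have -> : (fun y : 'rV[R]_n => (y - x0) 0 i) =
    (fun y : 'rV[R]_n => y 0 i) - cst (x0 0 i).
  by apply/funext => y; rewrite fctE !mxE.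
by have := is_diffB (is_diff_coord x 0 i) (is_diff_cst (x0 0 i) x); rewrite subr0.
Qed.

Lemma is_diff_paraboloid (x0 : 'rV[R]_2) (c r : R) x :
  is_diff x (fun y => c / 2 * (r - sqnorm (y - x0)))
            (fun v => - c * \sum_i (x - x0) 0 i * v 0 i).
Proof.
have d2 i := is_diffM (is_diff_coordB x0 x i) (is_diff_coordB x0 x i).
have := is_diffZ (c / 2) (is_diffB (is_diff_cst r x) (is_diffD (d2 0) (d2 1))).
rewrite sub0r => /is_diff_eq; apply; apply/funext => v.
by rewrite !fctE sum_ord2 /GRing.scale /=; field.
Qed.

Lemma partial_paraboloid (x0 : 'rV[R]_2) (c r : R) x i :
  partial i (fun y => c / 2 * (r - sqnorm (y - x0))) x = - c * (x - x0) 0 i.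
Proof.
have dp := is_diff_paraboloid x0 c r x.
rewrite /partial deriveE ?diff_val // (bigD1 i) //= big1 ?addr0 => [|j ji].
  by rewrite !mxE !eqxx mulr1.
by rewrite !mxE (negbTE ji) andbF mulr0.
Qed.

Definition disc (x0 : 'rV[R]_2) (r : R) := [set y | sqnorm (y - x0) < r ^+ 2].

Lemma continuous_sqnormB (x0 : 'rV[R]_2) :
  continuous (fun y : 'rV[R]_2 => sqnorm (y - x0)).
Proof.
have -> : (fun y : 'rV[R]_2 => sqnorm (y - x0)) =
    (fun y => - 2 / 2 * (0 - sqnorm (y - x0))) by apply/funext => z; field.
move=> y; apply: differentiable_continuous.
by have [] := is_diff_paraboloid x0 (- 2) 0 y.
Qed.

Lemma open_disc x0 r : open (disc x0 r).
Proof.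
apply: (@open_comp _ _ (fun y : 'rV[R]_2 => sqnorm (y - x0)) [set t | t < r ^+ 2]).
  by move=> y _; exact: continuous_sqnormB.
exact: open_lt.
Qed.

Lemma closure_disc x0 r y : closure (disc x0 r) y -> sqnorm (y - x0) <= r ^+ 2.
Proof.
have closedS : closed [set y : 'rV[R]_2 | sqnorm (y - x0) <= r ^+ 2].
  apply: (@closed_comp _ _ (fun y : 'rV[R]_2 => sqnorm (y - x0))
    [set t | t <= r ^+ 2]); last exact: closed_le.
  by move=> z _; exact: continuous_sqnormB.
suff /(_ y) : closure (disc x0 r) `<=`
    [set y : 'rV[R]_2 | sqnorm (y - x0) <= r ^+ 2] by [].
by rewrite (iffLR (closure_id _) closedS); apply: closureS => z /ltW.
Qed.

Lemma compact_closure_disc x0 r : 0 <= r -> compact (closure (disc x0 r)).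
Proof.
move=> r0; apply: bounded_closed_compact; last exact: closed_closure.
exists (r + `|x0|); split; first exact: num_real.
move=> M rM y /closure_disc/(norm_sqnorm r0) yr.
have := ler_normD (y - x0) x0; rewrite subrK => /le_trans; apply.
by apply: le_trans (ltW rM); rewrite lerD2r.
Qed.

(** The profile of the competitor; its gradient is [- c (x - x0)] for every
    radius. *)
Lemma C10_paraboloid x0 (c r : R) :
  C10 (disc x0 r) (fun y => c / 2 * (r ^+ 2 - sqnorm (y - x0))).
Proof.
have diffp y := is_diff_paraboloid x0 c (r ^+ 2) y.
have parc i : continuous (partial i (fun y => c / 2 * (r ^+ 2 - sqnorm (y - x0)))).
  have -> : partial i (fun y => c / 2 * (r ^+ 2 - sqnorm (y - x0))) =
      (fun y => - c * (y 0 i - x0 0 i)).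
    by apply/funext => y; rewrite partial_paraboloid !mxE.
  move=> y; apply: differentiable_continuous.
  by have [] := is_diffZ (- c)
    (is_diffB (is_diff_coord y 0 i) (is_diff_cst (x0 0 i) y)).
split; first split.
- by move=> y _; split => // i; exact: parc.
- apply: continuous_subspaceT => y.
  by apply: differentiable_continuous; have [] := diffp y.
- by move=> i; eexists; [apply: continuous_subspaceT; exact: parc|].
move=> y [/closure_disc yr]; rewrite (iffLR (interior_id _) (@open_disc x0 r)).
move=> /negP; rewrite -leNgt => ry.
by rewrite (@le_anti _ _ (sqnorm (y - x0)) (r ^+ 2)) ?yr // subrr mulr0.
Qed.

End Perturbation.

(** * The three properties of an immersion *)

Section Immersion.
Context (R : realType) (N : nat) (Omega : set 'rV[R]_2).
Context (u : 'rV[R]_2 -> 'rV[R]_N).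
Context (openOmega : open Omega) (u_imm : immersion Omega u).
Context (u_C2 : forall a : 'I_N, C2_on Omega (component a u)).

Let k x := dil (gradient u x).

Definition hess (x v : 'rV[R]_2) : 'M[R]_(N, 2) :=
  \matrix_(a, i) 'd (partial i (component a u)) x v.

Lemma is_diff_gradient x a i : Omega x ->
  is_diff x (fun y => gradient u y a i) (fun v => hess x v a i).
Proof.
move=> Ox.
have -> : (fun y => gradient u y a i) = partial i (component a u).
  by apply/funext => y; rewrite mxE.
have -> : (fun v => hess x v a i) = 'd (partial i (component a u)) x.
  by apply/funext => y; rewrite mxE.
by apply: differentiableP; have [_ /(_ i x Ox)[]] := u_C2 a.
Qed.

Lemma gradient_gt0 x : Omega x -> 0 < gdet (gradient u x).
Proof. by move=> Ox; apply/gdet_gt0/u_imm.2. Qed.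

Lemma is_diff_k x : Omega x ->
  is_diff x k (fun v => ddil (gradient u x) (hess x v)).
Proof.
move=> Ox; apply: is_diff_dil (gradient_gt0 Ox) => a i.
exact: is_diff_gradient.
Qed.

Lemma derive_k x v : Omega x -> 'D_v k x = ddil (gradient u x) (hess x v).
Proof. by move=> Ox; have dk := is_diff_k Ox; rewrite deriveE ?diff_val. Qed.

(** The chain rule turns the inner double sum of the system into a partial
    derivative of [k]. *)
Lemma system_iff_derive0 :
  dilation_system Omega u <-> forall x, Omega x -> forall v, 'D_v k x = 0.
Proof.
have sumE x a : Omega x -> \sum_(b < N) \sum_(i < 2) \sum_(j < 2)
      dilation_deriv (gradient u x) a i * dilation_deriv (gradient u x) b j
        * partial i (partial j (component b u)) x =
    \sum_i ddil (gradient u x) (hess x (delta_mx 0 i)) *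
      dilation_deriv (gradient u x) a i.
  move=> Ox; rewrite exchange_big; apply: eq_bigr => i _ /=.
  rewrite ddilE mulr_suml; apply: eq_bigr => b _.
  rewrite mulr_suml; apply: eq_bigr => j _.
  rewrite [dilation_deriv _ b j]dilation_derivE ?gradient_gt0 // [in RHS]mxE.
  rewrite /partial deriveE; first by ring.
  by have [_ /(_ j x Ox)[]] := u_C2 b.
split=> [sys x Ox v|k0 x Ox a].
  rewrite derive_partials; last by have [] := is_diff_k Ox.
  rewrite big1 // => i _; rewrite /partial derive_k //.
  have /dilation_deriv_eq0 := gradient_gt0 Ox.
  move=> /(_ (fun i => hess x (delta_mx 0 i))) [-> //]; first by rewrite mulr0.
  by move=> a; rewrite -sumE // sys.
rewrite sumE //; move: a; apply/dilation_deriv_eq0; first exact: gradient_gt0.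
by move=> i; rewrite -derive_k // k0.
Qed.

Lemma derive0_iff_constant :
  (forall x, Omega x -> forall v, 'D_v k x = 0) <->
  constant_dilation_on_components Omega u.
Proof.
split=> [k0 x Ox|kcst x Ox v].
  exists (k x) => y xy.
  have Oy : Omega y by exact: connected_component_sub xy.
  have kcst z : Omega z -> \forall w \near z, k w = k z.
    apply: (derive0_locally_constant openOmega) => w Ow.
    by split; [have [] := is_diff_k Ow|exact: k0].
  have kyx := locally_constant_component openOmega kcst Ox xy.
  by rewrite (dilationE (gradient_gt0 Oy)) -/(k y) kyx.
have [c kc] := kcst x Ox; rewrite -(@derive_cst _ _ _ c x v).
apply: near_eq_derive; near=> y.
have xy : connected_component Omega x y.
  by near: y; exact: (near_connected_component openOmega Ox).
have Oy : Omega y by exact: connected_component_sub xy.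
by have := kc y xy; rewrite (dilationE (gradient_gt0 Oy)) => -[].
Unshelve. all: by end_near. Qed.

(** The critical point of [f] has to be found in the level set of [k] through [x]
    inside [D], because [k] can take different values on different components. *)
Lemma derive0_locally_minimal :
  (forall x, Omega x -> forall v, 'D_v k x = 0) ->
  rank_one_locally_minimal_dilation Omega u.
Proof.
move=> k0 D openD compD DOmega f [[fC1 fcont _] f0] xi xi1.
have DO z : D z -> Omega z by move=> Dz; exact/DOmega/subset_closure.
have kdiff z : Omega z -> differentiable k z by move=> /is_diff_k[].
have kcst z : Omega z -> \forall y \near z, k y = k z.
  apply: (derive0_locally_constant openOmega) => y Oy.
  by split; [exact: kdiff|exact: k0].
set w := fun x => _.
have gradw z : D z -> gradient w z = gradient u z + xi^T *m \row_i partial i f z.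
  move=> Dz; apply: gradient_perturb; last by have [] := fC1 z Dz.
  by move=> a; have [/(_ z (DO _ Dz))[]] := u_C2 a.
suff key x : D x -> ((k x)%:E <= Kinf w D)%E.
  have : (0 <= Kinf w D)%E by exact: Lnorm_ge0.
  case KwD : (Kinf w D) key => [c| |] key // c0; last by rewrite leey.
  apply: Kinf_le => // x Dx.
  rewrite (dilationE (gradient_gt0 (DO x Dx))) gee0_abs ?lee_fin ?dil_ge0 //.
  by rewrite -lee_fin key.
move=> Dx; pose E := [set z | D z /\ k z = k x].
have openE : open E.
  rewrite openE => z [Dz kz]; have nearD := open_nbhs_nbhs (conj openD Dz).
  apply: filterS2 nearD (kcst z (DO z Dz)) => y Dy kyz.
  by split; [exact: Dy|rewrite kyz].
have clED : closure E `<=` closure D by apply: closureS => z [].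
have compE : compact (closure E).
  by apply: subclosed_compact compD clED; exact: closed_closure.
have fE0 z : (closure E `\` E) z -> f z = 0.
  move=> [Ez nEz]; apply: f0; split; first exact: clED.
  rewrite (iffLR (interior_id _) openD) => Dz; apply: nEz.
  have [y [[_ kyx] kyz]] := Ez _ (kcst _ (DO _ Dz)).
  by split; [exact: Dz|rewrite -kyz].
have [z [Dz kz] fz0] : exists2 z, E z & forall v, 'D_v f z = 0.
  apply: exists_critical_point openE compE _ _ _ fE0.
  - by exists x.
  - exact: continuous_subspaceW fcont.
  - by move=> y [Dy _]; have [] := fC1 y Dy.
have gradwz : gradient w z = gradient u z.
  have grad0 : \row_i partial i f z = 0.
    by apply/rowP => i; rewrite !mxE; exact: fz0.
  by rewrite (gradw z Dz) grad0 mulmx0 addr0.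
rewrite -kz leNgt; apply/negP => wk.
have [r wr rk] : exists2 r, (Kinf w D < r%:E)%E & r < k z.
  have : (0 <= Kinf w D)%E by exact: Lnorm_ge0.
  case: (Kinf w D) wk => [c|/lt_geF|_].
  - rewrite lte_fin => /midf_lt[ck kc] _; exists ((c + k z) / 2); last exact: kc.
    by rewrite lte_fin.
  - by rewrite leey.
  - by rewrite leeNy_eq.
suff near_r : \forall y \near z, (r%:E <= dilation (gradient w y))%E.
  by have := lt_le_trans wr (Kinf_ge openD Dz near_r); rewrite ltxx.
have wcont : {for z, continuous (fun y => gradient u y + xi^T *m \row_i partial i f y)}.
  apply: cvg_mx => a i.
  have -> : (fun y => (gradient u y + xi^T *m \row_i partial i f y) a i) =
      (fun y => gradient u y a i + xi 0 a * partial i f y).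
    by apply/funext => y; rewrite !mxE big_ord1 !mxE.
  have [/differentiable_continuous gradc _] := is_diff_gradient a i (DO _ Dz).
  have [_ /(_ i) partialc] := fC1 z Dz.
  exact: (cvgD gradc (cvgM (cvg_cst _) partialc)).
have [pert_gt0 pert_gt] : 0 < gdet (gradient u z + xi^T *m \row_i partial i f z) /\
    r < dil (gradient u z + xi^T *m \row_i partial i f z).
  by rewrite -(gradw z Dz) gradwz; split; [exact/gradient_gt0/DO|exact: rk].
have nearD := open_nbhs_nbhs (conj openD Dz).
apply: filterS2 nearD (near_dilation_gt wcont pert_gt0 pert_gt) => y Dy.
by rewrite (gradw y Dy).
Qed.

(** The paraboloid competitor, on a disc of radius
    [rho = 2 s |g|] with [s] small, which contains the point [x0 + s g] where [k]
    is large. *)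
Lemma locally_minimal_derive0 :
  rank_one_locally_minimal_dilation Omega u ->
  forall x, Omega x -> forall v, 'D_v k x = 0.
Proof.
move=> umin x0 Ox0; pose P := gradient u x0.
have P_gt0 : 0 < gdet P by exact: gradient_gt0.
have Pn0 : gdet P != 0 by rewrite gt_eqF.
have dk := is_diff_k Ox0; have [kdiff _] := dk.
pose g := \row_i partial i k x0.
suff g0 : sqnorm g = 0.
  move=> v; rewrite derive_partials // sum_ord2; move/eqP: g0.
  rewrite paddr_eq0 ?sqr_ge0 // !sqrf_eq0 !mxE => /andP[/eqP -> /eqP ->].
  by rewrite !mulr0 addr0.
have Dg w : 'D_w k x0 = g 0 0 * w 0 0 + g 0 1 * w 0 1.
  by rewrite derive_partials // sum_ord2 !mxE mulrC [X in _ + X]mulrC.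
have Dgg : 'D_g k x0 = sqnorm g by rewrite Dg -!expr2.
apply/eqP; apply: contraT => gn0.
have G_gt0 : 0 < sqnorm g by rewrite lt_def gn0 addr_ge0 ?sqr_ge0.
have s0 : shear P != 0.
  apply: contra gn0 => /eqP s0; rewrite -Dgg derive_k // ddil_conformal //.
have [xi0 xi0P] := ddil_represent g Pn0 s0.
pose n := frob xi0^T.
have trE (xi : 'rV[R]_N) : \tr (xi^T *m xi) = \sum_a xi 0 a ^+ 2.
  rewrite /mxtrace; apply: eq_bigr => a _.
  by rewrite mxE big_ord1 mxE -expr2.
have n_gt0 : 0 < n.
  rewrite sqrtr_gt0 trE lt_def sumr_ge0 ?andbT => [|a _]; last exact: sqr_ge0.
  apply: contra gn0 => /eqP xi00; rewrite -Dgg Dg -xi0P.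
  suff -> : xi0 = 0 by rewrite mul0mx ddilE big1 // => b _; rewrite big1 // => j _;
    rewrite mxE mul0r.
  apply/colP => a; rewrite mxE; apply/eqP; rewrite -sqrf_eq0; apply/eqP.
  have /psumr_eq0P := xi00 => /(_ _ a); rewrite mxE => -> // b _; exact: sqr_ge0.
pose xi := n^-1 *: xi0^T.
have xi1 : frob xi = 1.
  rewrite /frob trE; under eq_bigr do rewrite mxE exprMn.
  rewrite -mulr_sumr -trE sqrtrM ?sqr_ge0 // sqrtr_sqr gtr0_norm ?invr_gt0 //.
  by rewrite -/(frob _) -/n mulVf // gt_eqF.
(* the gradient of the competitor, whatever the radius of the disc *)
pose X y := gradient u y - xi0 *m (y - x0).
have dX a i : is_diff x0 (fun y => X y a i) (fun v => (hess x0 v - xi0 *m v) a i).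
  have -> : (fun y => X y a i) =
      (fun y => gradient u y a i - xi0 a 0 * (y - x0) 0 i).
    by apply/funext => y; rewrite /X !mxE big_ord1 !mxE.
  have := is_diffB (is_diff_gradient a i Ox0)
    (is_diffZ (xi0 a 0) (is_diff_coordB x0 x0 i)).
  move=> /is_diff_eq; apply; apply/funext => v.
  by rewrite !fctE !mxE big_ord1.
have X0 : X x0 = P by rewrite /X subrr mulmx0 subr0.
have X0_gt0 : 0 < gdet (X x0) by rewrite X0.
have dh : is_diff x0 (fun y => dil (X y)) 0.
  have := is_diff_dil dX X0_gt0 => /is_diff_eq; apply; apply/funext => v.
  by rewrite X0 ddilB xi0P -Dg derive_k // subrr.
pose r := Num.sqrt (sqnorm g).
have r_gt0 : 0 < r by rewrite sqrtr_gt0.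
have r2 : r ^+ 2 = sqnorm g by rewrite sqr_sqrtr ?ltW.
(* with slope r / 8, the competitor gains at most s r^2 / 4 on the disc of radius
   2 s r, against a gain of s r^2 / 2 for u at x0 + s g *)
have near_h : \forall y \near x0, [/\ Omega y, 0 < gdet (X y) &
    dil (X y) <= k x0 + r / 8 * `|y - x0|].
  have nearO := open_nbhs_nbhs (conj openOmega Ox0).
  have Xdiff a i : differentiable (fun y => X y a i) x0 by have [] := dX a i.
  have near_gt0 := near_gdet_gt0 Xdiff X0_gt0.
  have r8 : 0 < r / 8 by rewrite divr_gt0.
  apply: filterS3 nearO near_gt0 (is_diff0_near dh r8) => y Oy Xy.
  by rewrite X0 => /(le_trans (ler_norm _)); rewrite lerBlDl.
have near_k : \forall s \near 0^'+, k x0 + s * (r ^+ 2 / 2) < k (x0 + s *: g).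
  apply: near_derive_gt; first exact: diff_derivable.
  by rewrite Dgg r2 ltr_pdivrMr // ltr_pMr // ltr1n.
have /nbhs_ballP[d /= d_gt0 near_d] := near_h.
have [s [s_gt0 sd ks]] : exists s : R, [/\ 0 < s, 2 * s * r < d &
    k x0 + s * (r ^+ 2 / 2) < k (x0 + s *: g)].
  near (0 : R)^'+ => s; exists s; split => //; last by near: s.
  rewrite mulrAC mulrC -ltr_pdivlMr; last by rewrite mulr_gt0.
  by near: s; apply: nbhs_right_lt; rewrite divr_gt0 ?mulr_gt0.
pose rho := 2 * s * r.
have rho_gt0 : 0 < rho by rewrite !mulr_gt0.
have discd y : sqnorm (y - x0) <= rho ^+ 2 -> ball x0 d y.
  move=> /(norm_sqnorm (ltW rho_gt0)) yrho.
  by rewrite -ball_normE /= distrC (le_lt_trans yrho).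
have discO : closure (disc x0 rho) `<=` Omega.
  by move=> y /closure_disc/discd/near_d[].
have := umin _ (@open_disc _ x0 rho) (compact_closure_disc (ltW rho_gt0)) discO
  _ (C10_paraboloid x0 n rho) xi xi1.
set w := fun x => _.
rewrite leNgt => /negbTE <-.
have Kw : (Kinf w (disc x0 rho) <= (k x0 + s * (r ^+ 2 / 4))%:E)%E.
  apply: Kinf_le => [|y ydisc].
    by rewrite addr_ge0 ?dil_ge0 // mulr_ge0 ?divr_ge0 ?sqr_ge0 // ltW.
  have [Oy Xy_gt0 hy] := near_d y (discd y (ltW ydisc)).
  have dp := is_diff_paraboloid x0 n (rho ^+ 2) y.
  have -> : gradient w y = X y.
    have du a : differentiable (component a u) y by have [/(_ y Oy)[]] := u_C2 a.
    have [df _] := dp; rewrite (gradient_perturb xi du df).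
    congr (_ + _); apply/matrixP => a i; rewrite !mxE !big_ord1 !mxE.
    by rewrite partial_paraboloid !mxE; field; rewrite gt_eqF.
  rewrite dilationE // gee0_abs ?lee_fin ?dil_ge0 // (le_trans hy) // lerD2l.
  have /(norm_sqnorm (ltW rho_gt0)) yrho := ltW ydisc.
  have -> : s * (r ^+ 2 / 4) = r / 8 * rho by rewrite /rho; field.
  by rewrite ler_wpM2l // divr_ge0 // ltW.
have Ku : ((k x0 + s * (r ^+ 2 / 2))%:E <= Kinf u (disc x0 rho))%E.
  have sg : disc x0 rho (x0 + s *: g).
    rewrite /disc /= [x0 + _]addrC addrK sqnormZ -r2 -exprMn.
    by rewrite ltr_pXn2r ?nnegrE ?mulr_ge0 ?ltW // /rho -mulrA ltr_pMl ?mulr_gt0 ?ltr1n.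
  have [Os _ _] := near_d _ (discd _ (ltW sg)).
  apply: (Kinf_ge (@open_disc _ x0 rho) sg).
  have gradc : {for x0 + s *: g, continuous (gradient u)}.
    apply: cvg_mx => a i; have [+ _] := is_diff_gradient a i Os.
    exact: differentiable_continuous.
  exact: near_dilation_gt gradc (gradient_gt0 Os) ks.
apply: (le_lt_trans Kw); apply: lt_le_trans Ku; rewrite lte_fin ltrD2l ltr_pM2l //.
by rewrite ltr_pM2l ?exprn_gt0 // ltf_pV2 ?posrE // ltr_nat.
Unshelve. all: by end_near. Qed.

End Immersion.


Theorem proposition7p2 (R : realType) (N : nat) (hN : (2 <= N)%N)
    (Omega : set 'rV[R]_2) (openOmega : open Omega)
    (u : 'rV[R]_2 -> 'rV[R]_N)
    (u_immersion : immersion Omega u)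
    (u_C2 : forall a : 'I_N, C2_on Omega (component a u)) :
  (rank_one_locally_minimal_dilation Omega u <-> dilation_system Omega u) /\
  (dilation_system Omega u <-> constant_dilation_on_components Omega u).
Proof.
have sys := system_iff_derive0 u_immersion u_C2.
split; last first.
  exact: (iff_trans sys (derive0_iff_constant openOmega u_immersion u_C2)).
split => [umin|/sys k0].
  by apply/sys; exact: (locally_minimal_derive0 openOmega u_immersion u_C2).
exact: (derive0_locally_minimal openOmega u_immersion u_C2).
Qed.
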